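(* Let $A\in\mathbb{R}^{M\times N}$ have nonzero columns and $\operatorname{rank}(A)=M<N$, and let $d\in\mathbb{R}^M$. For any $K\in\{1,\dots,M-1\}$ there exists $\beta_K\ge0$ such that if $\beta>\beta_K$, then each global minimizer $\hat u$ of $F_d(u)=\|Au-d\|_2^2+\beta\|u\|_0$ satisfies $$\|\hat u\|_0\le K\quad\text{and}\quad\sigma(\hat u)\in\overline{\Omega}_K.$$ One can choose $\beta_K=\|A\tilde u-d\|_2^2$, where $\tilde u$ solves problem $(\mathcal P_\omega)$ for some (any chosen) $\omega\in\Omega_K$.
   Context: $\mathbb{I}_N=\{1,\dots,N\}$. For $u\in\mathbb{R}^N$, $\sigma(u)=\{i\in\mathbb{I}_N: u[i]\ne0\}$ and $\|u\|_0=\#\sigma(u)$. For $\omega\subseteq\mathbb{I}_N$, problem $(\mathcal P_\omega)$ is: minimize $\|Au-d\|_2^2$ over $u\in\mathbb{R}^N$ subject to $u[i]=0$ for all $i\in\mathbb{I}_N\setminus\omega$. $A_\omega\in\mathbb{R}^{M\times\#\omega}$ is the submatrix of $A$ formed by the columns indexed by $\omega$, with $\operatorname{rank}(A_\varnothing)=0$. For $r\in\{1,\dots,M\}$, $\Omega_r=\{\omega\subset\mathbb{I}_N:\#\omega=r=\operatorname{rank}(A_\omega)\}$; $\Omega_0=\{\varnothing\}$; $\overline{\Omega}_K=\bigcup_{r=0}^{K}\Omega_r$. *)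

(* Defs.v *)
From mathcomp Require Import all_boot all_order all_algebra.
From mathcomp Require Import reals.

Set Implicit Arguments.
Unset Strict Implicit.
Unset Printing Implicit Defensive.

Import Order.TTheory GRing.Theory Num.Theory.
Local Open Scope ring_scope.

Section Defs.
Variables (R : realType) (M N : nat).
Implicit Types (A : 'M[R]_(M, N)) (d : 'cV[R]_M) (u : 'cV[R]_N).
Implicit Types (w : {set 'I_N}).

Definition l2norm n (v : 'cV[R]_n) : R := Num.sqrt (\sum_(i < n) v i 0 ^+ 2).

Definition support_set u : {set 'I_N} := [set i | u i 0 != 0].

Definition l0norm u : nat := #|support_set u|.

Definition objective A d (beta : R) u : R :=
  l2norm (A *m u - d) ^+ 2 + beta * (l0norm u)%:R.

Definition global_minimizer (F : 'cV[R]_N -> R) u : Prop :=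
  forall v, F u <= F v.

Definition feasible w u : Prop := forall i, i \notin w -> u i 0 = 0.

Definition solves_restricted A d w u : Prop :=
  feasible w u /\
  forall v, feasible w v -> l2norm (A *m u - d) ^+ 2 <= l2norm (A *m v - d) ^+ 2.

Definition column_submx A w : 'M[R]_(M, #|w|) :=
  colsub (fun j : 'I_#|w| => enum_val j) A.

(* The formula is used for every r; by [Omega0] it yields {set0} at r = 0. *)
Definition Omega A (r : nat) : {set {set 'I_N}} :=
  [set w : {set 'I_N} | (#|w| == r) && (\rank (column_submx A w) == r)].

Definition Omega_bar A (K : nat) : {set {set 'I_N}} :=
  \bigcup_(r < K.+1) Omega A r.

Lemma Omega0 A : Omega A 0 = [set set0].
Proof.
apply/setP=> w; rewrite !inE cards_eq0.
case: eqVneq => [->|//] /=; rewrite -leqn0.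
by apply: leq_trans (rank_leq_col _) _; rewrite cards0.
Qed.

Definition sparsity_threshold A d (K : nat) (beta_K : R) : Prop :=
  forall beta : R, beta_K < beta ->
  forall uhat : 'cV[R]_N, global_minimizer (objective A d beta) uhat ->
  (l0norm uhat <= K)%N /\ support_set uhat \in Omega_bar A K.

End Defs.

(* Main.v *)
Require Import Defs.
From mathcomp Require Import all_boot all_order all_algebra.
From mathcomp Require Import reals.

(** If [u] is a global minimizer and [utilde] is supported in a set of [K]
    columns, then [beta * |u|_0 <= F u <= F utilde < beta + beta * K] as soon as
    [beta] exceeds the residual of [utilde]; hence [|u|_0 <= K]. The columns of
    [A] over the support of [u] are independent: subtracting a suitable multiple
    of a kernel vector supported there would delete a coordinate of [u] without
    changing [A u], lowering the objective. *)

Set Implicit Arguments.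
Unset Strict Implicit.
Unset Printing Implicit Defensive.

Import Order.TTheory GRing.Theory Num.Theory.
Local Open Scope ring_scope.

Lemma sqr_l2norm (R : realType) n (v : 'cV[R]_n) :
  l2norm v ^+ 2 = (v^T *m v) 0 0.
Proof.
rewrite /l2norm sqr_sqrtr; last by apply: sumr_ge0 => i _; rewrite sqr_ge0.
by rewrite mxE; apply: eq_bigr => i _; rewrite mxE expr2.
Qed.

Lemma l2norm_eq0 (R : realType) n (v : 'cV[R]_n) : l2norm v ^+ 2 = 0 -> v = 0.
Proof.
rewrite /l2norm sqr_sqrtr; last by apply: sumr_ge0 => i _; rewrite sqr_ge0.
move=> /eqP; rewrite psumr_eq0; last by move=> i _; rewrite sqr_ge0.
move=> /allP v0; apply/colP=> i; rewrite mxE; apply/eqP.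
by have := v0 i (mem_index_enum i); rewrite sqrf_eq0.
Qed.

(** The rank lost in [B^T *m B] is the dimension of the row space of [B^T] intersected with the
    kernel of [B]. A vector [v = y *m B^T] with [v *m B = 0] has [v *m v^T = 0], hence vanishes over
    the reals. *)
Lemma mxrank_gram (R : realType) m n (B : 'M[R]_(m, n)) :
  \rank (B^T *m B) = \rank B.
Proof.
have capB0 : (B^T :&: kermx B)%MS = 0.
  apply/eqP; rewrite -submx0; apply/rV_subP=> v.
  rewrite sub_capmx => /andP[/submxP[y vE] /sub_kermxP vB0].
  suff: v^T = 0 by move/(congr1 trmx); rewrite trmxK trmx0 => ->; rewrite sub0mx.
  apply: l2norm_eq0.
  by rewrite sqr_l2norm trmxK {2}vE trmx_mul trmxK mulmxA vB0 mul0mx mxE.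
by have := mxrank_mul_ker B^T B; rewrite capB0 mxrank0 addn0 mxrank_tr.
Qed.

(** By equality of ranks, [B^T *m B] and [B] have the same row space, which contains [d^T *m B]. *)
Lemma normal_equations_solvable (R : realType) m n (B : 'M[R]_(m, n))
    (d : 'cV[R]_m) :
  exists x : 'cV[R]_n, B^T *m (B *m x - d) = 0.
Proof.
have /submxP[y dE] : (d^T *m B <= B^T *m B)%MS.
  apply: (submx_trans (submxMl _ _)).
  by rewrite -(mxrank_leqif_sup (submxMl B^T B)) mxrank_gram.
exists y^T; rewrite mulmxBr mulmxA.
have -> : B^T *m d = (d^T *m B)^T by rewrite trmx_mul trmxK.
by rewrite dE !trmx_mul trmxK subrr.
Qed.

(** Pythagoras: the residual [r] at [x] is orthogonal to the column space of [B], where [h] lies. *)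
Lemma normal_equations_minimize (R : realType) m n (B : 'M[R]_(m, n))
    (d : 'cV[R]_m) (x : 'cV[R]_n) :
  B^T *m (B *m x - d) = 0 ->
  forall y, l2norm (B *m x - d) ^+ 2 <= l2norm (B *m y - d) ^+ 2.
Proof.
move=> Bx y; set r := B *m x - d in Bx *; set h := B *m (y - x).
have hr : h^T *m r = 0 by rewrite trmx_mul -mulmxA Bx mulmx0.
have rh : r^T *m h = 0 by rewrite -[h]trmxK -trmx_mul hr trmx0.
have -> : B *m y - d = r + h by rewrite /h /r mulmxBr [RHS]addrC addrA subrK.
clearbody r h; rewrite [leRHS]sqr_l2norm [(r + h)^T]linearD mulmxDl !mulmxDr.
by rewrite hr rh addr0 add0r mxE -!sqr_l2norm lerDl sqr_ge0.
Qed.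

Section Columns.
Variables (R : realType) (M N : nat) (A : 'M[R]_(M, N)).
Implicit Types (w : {set 'I_N}) (u z : 'cV[R]_N) (d : 'cV[R]_M).

(** Extension by zero of a vector indexed by [w]. *)
Definition coord_inj w : 'M[R]_(N, #|w|) := column_submx 1%:M w.

Lemma column_submxE w : column_submx A w = A *m coord_inj w.
Proof. by rewrite /coord_inj /column_submx mulmx_colsub mulmx1. Qed.

Lemma coord_injE w (x : 'cV[R]_#|w|) (j : 'I_#|w|) :
  (coord_inj w *m x) (enum_val j) 0 = x j 0.
Proof.
rewrite mxE (bigD1 j)//= !mxE eqxx mul1r big1 ?addr0// => k kj.
by rewrite !mxE (inj_eq enum_val_inj) eq_sym (negPf kj) mul0r.
Qed.

Lemma feasible_coord_inj w (x : 'cV[R]_#|w|) : feasible w (coord_inj w *m x).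
Proof.
move=> i iw; rewrite mxE big1// => k _; rewrite !mxE.
case: eqP => [iE|_]; last by rewrite mul0r.
by move: iw; rewrite iE enum_valP.
Qed.

Lemma feasibleP w u :
  feasible w u <-> exists x : 'cV[R]_#|w|, u = coord_inj w *m x.
Proof.
split=> [uw|[x ->]]; last exact: feasible_coord_inj.
exists (\col_j u (enum_val j) 0); apply/colP=> i.
have [iw|iw] := boolP (i \in w); last by rewrite uw// feasible_coord_inj.
by rewrite -(enum_rankK_in iw iw) coord_injE mxE.
Qed.

(** Trades the rank condition for injectivity of [A] on vectors supported in [w], which is easier to
    restrict to subsets and to perturb along. *)
Lemma column_rankP w :
  \rank (column_submx A w) = #|w| <->
  forall z, feasible w z -> A *m z = 0 -> z = 0.
Proof.
rewrite -mxrank_tr; split=> [wr z /feasibleP[x ->]|ker0].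
  rewrite mulmxA -column_submxE => Bx0.
  have Bfree : row_free (column_submx A w)^T by rewrite /row_free wr.
  suff -> : x = 0 by rewrite mulmx0.
  apply: trmx_inj; apply: (row_free_inj Bfree).
  by rewrite -trmx_mul Bx0 !trmx0 mul0mx.
apply/eqP; rewrite -/(row_free _) -kermx_eq0 -submx0; apply/rV_subP=> y.
move=> /sub_kermxP /(congr1 trmx); rewrite trmx_mul trmxK trmx0.
rewrite column_submxE -mulmxA => /ker0 - /(_ (feasible_coord_inj _)) Ey0.
suff -> : y = 0 by rewrite sub0mx.
by apply/rowP=> j; have := coord_injE y^T j; rewrite Ey0 !mxE => <-.
Qed.

Lemma in_Omega w r :
  w \in Omega A r <->
  #|w| = r /\ forall z, feasible w z -> A *m z = 0 -> z = 0.
Proof.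
rewrite inE; split=> [/andP[/eqP wr /eqP rr]|[<- /column_rankP ->]].
  by split=> //; apply/column_rankP; rewrite rr wr.
by rewrite !eqxx.
Qed.

Lemma Omega_rank_nonempty : exists w, w \in Omega A (\rank A).
Proof.
(* A maximal independent family of rows of [A^T] indexes a basis of the column space of [A]. *)
pose f := maxrankfun A^T; pose w := [set f i | i : 'I_(\rank A^T)].
have wc : #|w| = \rank A.
  by rewrite card_imset ?card_ord ?mxrank_tr//; exact: maxrankfun_inj.
have wr : (\rank (column_submx A w) <= \rank A)%N by rewrite -wc rank_leq_col.
exists w; rewrite inE; apply/andP; split; first exact/eqP.
rewrite eqn_leq wr /= -mxrank_tr -[\rank (column_submx _ _)]mxrank_tr.
rewrite -(eq_maxrowsub A^T); apply: mxrankS; apply/row_subP=> i.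
have fiw : f i \in w by apply: imset_f.
have -> : row i (rowsub f A^T) =
          row (enum_rank_in fiw (f i)) (column_submx A w)^T.
  by apply/rowP=> j; rewrite !mxE enum_rankK_in.
exact: row_sub.
Qed.

(** Any [K] elements of [w] will do, since independence passes to subfamilies. *)
Lemma Omega_nonempty_leq w r K : w \in Omega A r -> (K <= r)%N ->
  exists v : {set 'I_N}, v \in Omega A K.
Proof.
move=> /in_Omega[wr ker0] Kr.
have tsz : size (take K (enum w)) = K by rewrite size_takel// -cardE wr.
exists [set i in take K (enum w)]; apply/in_Omega; split.
  by rewrite cardsE (card_uniqP _) // take_uniq// enum_uniq.
move=> z zv; apply: ker0 => i iw; apply: zv; rewrite inE.
by apply: contra iw => /mem_take; rewrite mem_enum.
Qed.

(** Through [coord_inj], the restricted problem is ordinary least squares for [column_submx A w]. *)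
Lemma solves_restricted_exists d w : exists u, solves_restricted A d w u.
Proof.
have [x Bx] := normal_equations_solvable (column_submx A w) d.
exists (coord_inj w *m x); split; first exact: feasible_coord_inj.
move=> v /feasibleP[y ->]; rewrite !mulmxA -column_submxE.
exact: normal_equations_minimize.
Qed.

Lemma l0norm_feasible w u : feasible w u -> (l0norm u <= #|w|)%N.
Proof.
move=> uw; apply/subset_leq_card/subsetP=> i; rewrite inE.
by apply: contraR => /uw ->.
Qed.

Lemma minimizer_support d (beta : R) u : 0 < beta ->
  global_minimizer (objective A d beta) u ->
  support_set u \in Omega A (l0norm u).
Proof.
move=> beta0 umin; apply/in_Omega; split=> // z zu Az0.
apply/colP=> i; rewrite mxE; apply/eqP; apply: contraT => zi0.
(* The ratio [t] cancels coordinate [i]. The residual is unchanged, so minimality compares the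
   supports only, while the new support is a proper subset. *)
set t := u i 0 / z i 0; have := umin (u - t *: z); rewrite /objective.
rewrite mulmxBr -scalemxAr Az0 scaler0 subr0 lerD2l ler_pM2l// ler_nat.
apply: contraTT => _; rewrite -ltnNge.
apply/proper_card/properP; split.
  apply/subsetP=> j; rewrite inE; apply: contraR => ju.
  have uj0 : u j 0 = 0 by move: ju; rewrite inE negbK => /eqP.
  by rewrite !mxE uj0 (zu _ ju) mulr0 subrr.
exists i; first by apply: contraT => /zu zi; rewrite zi eqxx in zi0.
by rewrite inE !mxE /t divfK// subrr eqxx.
Qed.

Lemma sparsity_threshold_feasible d w u K : (#|w| <= K)%N -> feasible w u ->
  sparsity_threshold A d K (l2norm (A *m u - d) ^+ 2).
Proof.
move=> wK uw beta betau v vmin.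
have beta0 : 0 < beta by apply: le_lt_trans betau; rewrite sqr_ge0.
have vK : (l0norm v <= K)%N.
  rewrite -ltnS -(ltr_nat R) -(ltr_pM2l beta0).
  have vle : beta * (l0norm v)%:R <= objective A d beta v.
    by rewrite lerDr sqr_ge0.
  apply: (le_lt_trans (le_trans vle (vmin u))).
  (* In [beta * (K + 1)], one [beta] strictly dominates the residual and [beta * K] dominates the
     penalty of [u]. *)
  rewrite -natr1 mulrDr mulr1 addrC /objective ltr_leD//.
  by rewrite ler_pM2l// ler_nat (leq_trans (l0norm_feasible uw)).
split=> //; apply/bigcupP; exists (Ordinal (vK : (l0norm v < K.+1)%N)) => //=.
exact: minimizer_support vmin.
Qed.

End Columns.

Theorem proposition4p5 (R : realType) (M N : nat)
    (A : 'M[R]_(M, N)) (d : 'cV[R]_M)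
    (hcol : forall j : 'I_N, col j A != 0)
    (hrank : \rank A = M) (hMN : (M < N)%N)
    (K : nat) (hK : (1 <= K <= M - 1)%N) :
  (exists beta_K : R, 0 <= beta_K /\ sparsity_threshold A d K beta_K) /\
  (exists w : {set 'I_N}, w \in Omega A K) /\
  (forall w : {set 'I_N}, w \in Omega A K ->
     (exists utilde : 'cV[R]_N, solves_restricted A d w utilde) /\
     (forall utilde : 'cV[R]_N, solves_restricted A d w utilde ->
        sparsity_threshold A d K (l2norm (A *m utilde - d) ^+ 2))).
Proof.
(* Full row rank leaves room for [K] independent columns. *)
have KM : (K <= \rank A)%N.
  by case/andP: hK => _ /leq_trans; apply; rewrite hrank leq_subr.
have [w0 w0M] := Omega_rank_nonempty A.
have [w wK] := Omega_nonempty_leq w0M KM.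
have threshold v u : v \in Omega A K -> solves_restricted A d v u ->
    sparsity_threshold A d K (l2norm (A *m u - d) ^+ 2).
  move=> /in_Omega[vK _] [uv _].
  by apply: sparsity_threshold_feasible uv; rewrite vK.
split; last split.
- have [u uw] := solves_restricted_exists A d w.
  by exists (l2norm (A *m u - d) ^+ 2); split; [exact: sqr_ge0|exact: threshold uw].
- by exists w.
- by move=> v vK; split=> [|u]; [exact: solves_restricted_exists|exact: threshold].
Qed.
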